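(* Let $q\in(0,1)$ and $r=1-q$, and consider the random graph process $\mathcal{I}_C$ with parameters $q,r$. For all integers $t\ge 0$ and $m\ge 0$, the probability $p_t(\mathbf{m}=m)$ that the graph has exactly $m$ edges at step $t$ is $$p_t(\mathbf{m}=m)=\begin{cases}1 & t=m,\\ 0 & t\neq m.\end{cases}$$
   Context: The probabilistic inductive class $\mathcal{I}_C$ (connected undirected graphs, multiple edges allowed, no loops) is the following random graph process. At step $0$ the graph is a single vertex with no edges. At each step one rule is chosen and applied: rule R1 with probability $q$, rule R2 with probability $r=1-q$, independently of the past; except that at the first step only R1 can be applied, so R1 is applied at step $1$ with certainty. R1: choose a vertex uniformly at random, and add one new vertex and one edge joining it to the chosen vertex. R2: choose two different vertices uniformly at random (possibly already adjacent) and add one edge joining them. $\mathbf{m}$ is the number of edges. *)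

(* Defs.v *)
From HB Require Import structures.
From mathcomp Require Import all_boot all_order all_algebra.
From mathcomp Require Import finmap multiset.
From mathcomp Require Import all_classical all_reals all_analysis.
From mathcomp Require Import giry.

Set Implicit Arguments.
Unset Strict Implicit.
Unset Printing Implicit Defensive.

Import Order.TTheory GRing.Theory Num.Theory.

Local Open Scope fset_scope.
Local Open Scope mset_scope.
Local Open Scope classical_set_scope.
Local Open Scope ring_scope.

(* An edge is an unordered pair of vertices, i.e. an [fset] of two naturals;
   edges are collected in a multiset so that parallel edges are counted. *)
Definition loopless (n : nat) (E : {mset {fset nat}}) : bool :=
  all (fun e : {fset nat} => [exists u : 'I_n, exists v : 'I_n,
    (u != v) && (e == [fset val u; val v])]) E.

Definition adjacent (n : nat) (E : {mset {fset nat}}) : rel 'I_n :=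
  fun u v => [fset val u; val v] \in E.

Definition connected_graph (n : nat) (E : {mset {fset nat}}) : bool :=
  (0 < n)%N && [forall u : 'I_n, forall v : 'I_n, connect (adjacent E) u v].

(* Connected loopless multigraphs on the vertex set {0, ..., nverts - 1}. *)
Record mgraph := MGraph {
  nverts : nat;
  edges : {mset {fset nat}};
  mgraph_loopless : loopless nverts edges;
  mgraph_connected : connected_graph nverts edges }.

Definition nedges (g : mgraph) : nat := size (edges g).

Lemma point_loopless : loopless 1 mset0.
Proof. by apply/allP => e; rewrite in_mset0. Qed.

Lemma point_connected : connected_graph 1 mset0.
Proof.
by apply/andP; split=> //; apply/forallP => u; apply/forallP => v;
  rewrite (ord1 u) (ord1 v) connect0.
Qed.

Definition point_graph : mgraph := MGraph point_loopless point_connected.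

Lemma loopless_R1 (g : mgraph) (v : 'I_(nverts g)) :
  loopless (nverts g).+1 ([fset val v; nverts g] +` edges g).
Proof.
apply/allP => e; rewrite in_mset1D => /orP[/eqP->|eg].
  apply/existsP; exists (widen_ord (leqnSn _) v).
  apply/existsP; exists ord_max; rewrite eqxx andbT.
  by rewrite -val_eqE /= ltn_eqF.
have /existsP[u /existsP[w /andP[uw /eqP->]]] :=
  allP (mgraph_loopless g) _ eg.
apply/existsP; exists (widen_ord (leqnSn _) u).
by apply/existsP; exists (widen_ord (leqnSn _) w); rewrite -val_eqE /= uw /=.
Qed.

Lemma connected_R1 (g : mgraph) (v : 'I_(nverts g)) :
  connected_graph (nverts g).+1 ([fset val v; nverts g] +` edges g).
Proof.
set n := nverts g in v *; set E := _ +` _.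
have wadj (a b : 'I_n) :
    connect (adjacent E) (widen_ord (leqnSn n) a) (widen_ord (leqnSn n) b).
  have /andP[_ /forallP/(_ a)/forallP/(_ b)] := mgraph_connected g.
  move=> /connectP[p pth ->]; elim: p a pth => [|c p IH] a //=.
  move=> /andP[ac /IH]; apply: connect_trans; apply: connect1.
  by rewrite /adjacent in_mset1D; apply/orP; right.
have symE : connect_sym (@adjacent n.+1 E).
  by apply: sym_connect_sym => a b; rewrite /adjacent fsetUC.
have toV (a : 'I_n.+1) : connect (adjacent E) a (widen_ord (leqnSn n) v).
  have [an|] := ltnP a n.
    by rewrite (_ : a = widen_ord (leqnSn n) (Ordinal an)) //; apply: val_inj.
  move=> na; have -> : a = ord_max.
    by apply: val_inj; apply/eqP; rewrite eqn_leq na -ltnS ltn_ord.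
  rewrite symE; apply: connect1.
  by rewrite /adjacent in_mset1D; apply/orP; left; rewrite eqxx.
apply/andP; split=> //; apply/forallP => a; apply/forallP => b.
by apply: (connect_trans (toV a)); rewrite symE.
Qed.

Definition add_vertex (g : mgraph) (v : 'I_(nverts g)) : mgraph :=
  MGraph (loopless_R1 v) (connected_R1 v).

Definition distinct_pair (g : mgraph) : finType :=
  {p : 'I_(nverts g) * 'I_(nverts g) | p.1 != p.2}.

Lemma loopless_R2 (g : mgraph) (p : distinct_pair g) :
  loopless (nverts g) ([fset val (val p).1; val (val p).2] +` edges g).
Proof.
apply/allP => e; rewrite in_mset1D => /orP[/eqP->|eg].
  apply/existsP; exists (val p).1; apply/existsP; exists (val p).2.
  by rewrite eqxx andbT; exact: (valP p).
exact: (allP (mgraph_loopless g)).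
Qed.

Lemma connected_R2 (g : mgraph) (p : distinct_pair g) :
  connected_graph (nverts g) ([fset val (val p).1; val (val p).2] +` edges g).
Proof.
have /andP[n0 /forallP c] := mgraph_connected g.
apply/andP; split=> //; apply/forallP => a; apply/forallP => b.
have := forallP (c a) b; apply: connect_sub => {a b} x y xy.
by apply: connect1; rewrite /adjacent in_mset1D; apply/orP; right.
Qed.

Definition add_edge (g : mgraph) (p : distinct_pair g) : mgraph :=
  MGraph (loopless_R2 p) (connected_R2 p).

HB.instance Definition _ := gen_eqMixin mgraph.
HB.instance Definition _ := gen_choiceMixin mgraph.
HB.instance Definition _ := isPointed.Build mgraph point_graph.
HB.instance Definition _ := @isMeasurable.Build default_measure_display
  mgraph discrete_measurable discrete_measurable0
  discrete_measurableC discrete_measurableU.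

(* [giry_bind] between probability measures; the library only records that the
   result is a subprobability measure. *)
Section prob_bind.
Context d1 d2 (T1 : measurableType d1) (T2 : measurableType d2) (R : realType).
Variables (mu : probability T1 R) (k : T1 -> probability T2 R).
Hypothesis mk : measurable_fun [set: T1] (fun x => k x : giry T2 R).

Definition prob_bind_fun : set T2 -> \bar R :=
  giry_bind (mu : giry T1 R) mk.

HB.instance Definition _ := Measure.on prob_bind_fun.

Lemma prob_bind_setT : prob_bind_fun [set: T2] = 1%E.
Proof.
rewrite -[LHS]mul1e -(integral_cst _ measurableT).
rewrite [LHS](@giry_int_bind _ _ _ _ _ mu _ mk (cst 1%E))//.
transitivity (\int[mu]_x 1%E)%E.
  apply: eq_integral => x _; rewrite /giry_int integral_cst// mul1e.
  exact: probability_setT.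
by rewrite integral_cst// mul1e; exact: probability_setT.
Qed.

HB.instance Definition _ :=
  @Measure_isProbability.Build _ _ R prob_bind_fun prob_bind_setT.

Definition prob_bind : probability T2 R := prob_bind_fun.

End prob_bind.
Arguments prob_bind {d1 d2 T1 T2 R} mu {k} mk.

(* Law of [f i] for [i] uniform in the finite type [I]. When [I] is empty,
   [mnormalize] falls back on the Dirac mass at [x0]. *)
Definition uniform_image {d} {T : measurableType d} (R : realType)
    (I : finType) (f : I -> T) (x0 : T) : probability T R :=
  mnormalize (msum (fun k => \d_(nth x0 (codom f) k)) #|I|) \d_x0.

Definition R1 (R : realType) (g : mgraph) : probability mgraph R :=
  uniform_image R (@add_vertex g) g.

(* A uniform ordered pair of different vertices induces a uniform unordered
   one. No such pair exists in the one-vertex graph, where the fallback of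
   [uniform_image] leaves [g] unchanged; the process never applies R2 there. *)
Definition R2 (R : realType) (g : mgraph) : probability mgraph R :=
  uniform_image R (@add_edge g) g.

Definition apply_rule (R : realType) (g : mgraph) (isR1 : bool) :
  probability mgraph R := if isR1 then R1 R g else R2 R g.

Lemma measurable_apply_rule (R : realType) (g : mgraph) :
  measurable_fun [set: bool] (fun b => apply_rule R g b : giry mgraph R).
Proof. by []. Qed.

(* Transition from step [t] to step [t.+1]: R1 with certainty at the first
   step, afterwards R1 with probability [q] and R2 with probability [1 - q]. *)
Definition step (R : realType) (q : R) (t : nat) (g : mgraph) :
    probability mgraph R :=
  if t == 0%N then R1 R g
  else prob_bind (bernoulli_prob q) (measurable_apply_rule (R := R) g).

Lemma measurable_step (R : realType) (q : R) (t : nat) :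
  measurable_fun [set: mgraph] (fun g => step q t g : giry mgraph R).
Proof. by []. Qed.

(* Law of the graph at step [t]: each step uses fresh randomness, independent
   of the past. *)
Fixpoint law (R : realType) (q : R) (t : nat) : probability mgraph R :=
  if t is t'.+1 then prob_bind (law q t') (measurable_step q t')
  else \d_point_graph.

(* Main.v *)
(* Every rule adds exactly one edge.  R2 is applicable from step 1 on: the first
   step is R1, so the graph then has at least two vertices and keeps them.
   Hence the law at step [t] is concentrated on the graphs with [t] edges and,
   when [t > 0], more than one vertex. *)
Require Import Defs.
From mathcomp Require Import all_boot all_order all_algebra.
From mathcomp Require Import all_classical all_reals all_analysis.
From mathcomp Require Import multiset measurable_realfun giry.

Import Order.TTheory GRing.Theory Num.Theory.

Local Open Scope classical_set_scope.
Local Open Scope ring_scope.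

(** The mass of [A] is the [mu]-average of [k x A], and this integrand is 1 off the complement of
    [B], a null set. *)
Lemma prob_bind_eq1 {d1 d2} {T1 : measurableType d1} {T2 : measurableType d2}
    {R : realType} (mu : probability T1 R) (k : T1 -> probability T2 R)
    (mk : measurable_fun [set: T1] (fun x => k x : giry T2 R))
    (B : set T1) (A : set T2) :
  measurable B -> measurable A -> mu B = 1%E ->
  (forall x, B x -> k x A = 1%E) -> prob_bind mu mk A = 1%E.
Proof.
move=> mB mA muB kA.
have mev : measurable_fun [set: T1] (fun x => k x A : \bar R).
  exact: (measurableT_comp (measurable_giry_ev mA) mk).
(* The bind integrates evaluation at [A] against the image of [mu] under [k]; change of variables
   brings this back to [mu]. *)
have -> : prob_bind mu mk A = (\int[mu]_x k x A)%E.
  exact: (@giry_int_map _ _ _ _ R _ mk (mu : giry T1 R) (giry_ev ^~ A)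
    (measurable_giry_ev mA) (fun=> measure_ge0 _ _)).
rewrite -[RHS](probability_setT mu) -[RHS]mul1e -integral_cst//.
apply: ae_eq_integral => //.
exists (~` B); split; first exact: measurableC.
  by rewrite -[LHS]/(mu _) probability_setC// muB subee//.
by apply: subsetC => x Bx _; exact: kA.
Qed.

(** Each Dirac mass gives 1 both to [A] and to the whole space, so numerator and normalising
    constant are both [#|I|]. *)
Lemma uniform_image_eq1 {d} {T : measurableType d} {R : realType} {I : finType}
    (f : I -> T) (x0 : T) (A : set T) :
  (0 < #|I|)%N -> (forall i, A (f i)) -> uniform_image R f x0 A = 1%E.
Proof.
move=> I0 fA.
have sumE (B : set T) : (forall i, B (f i)) ->
    (\sum_(k < #|I|) \d_(nth x0 (codom f) k) B = #|I|%:R%:E :> \bar R)%E.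
  move=> fB; rewrite (eq_bigr (fun=> 1%:E)) => [|k _].
    by rewrite sumEFin sumr_const card_ord.
  rewrite /= diracE mem_set//.
  have : nth x0 (codom f) k \in codom f by rewrite mem_nth// size_codom.
  by case/codomP => i ->.
have I0R : #|I|%:R != 0 :> R by rewrite pnatr_eq0 -lt0n.
(* The total mass [#|I|] is finite and nonzero, which excludes the fallback branch of
   [mnormalize]. *)
rewrite -[LHS]/(mnormalize _ _ _) /mnormalize /= /msum (sumE setT)//.
by rewrite orbF eqe (negbTE I0R) (sumE A)// -EFinM divff.
Qed.

(** Size counts multiplicity, so an edge parallel to an existing one still adds 1. *)
Lemma size_mset1D (K : choiceType) (x : K) (A : {mset K}%mset) :
  size (x +` A)%mset = (size A).+1.
Proof.
suff /perm_size -> : perm_eq (x +` A)%mset (x :: A) by [].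
by apply/allP => y _ /=; rewrite !count_mem_mset mset1DE (eq_sym x).
Qed.

Lemma nedges_add_vertex (g : mgraph) (v : 'I_(nverts g)) :
  nedges (add_vertex v) = (nedges g).+1.
Proof. by rewrite /nedges size_mset1D. Qed.

Lemma nedges_add_edge (g : mgraph) (p : distinct_pair g) :
  nedges (add_edge p) = (nedges g).+1.
Proof. by rewrite /nedges size_mset1D. Qed.

(** The guard [0 < t] exempts the one-vertex start. *)
Definition typical (t : nat) : set mgraph :=
  [set g | nedges g = t /\ ((0 < t)%N -> (1 < nverts g)%N)].

Lemma nverts_gt0 (g : mgraph) : (0 < nverts g)%N.
Proof. by case/andP: (mgraph_connected g). Qed.

(** Connectedness includes having a vertex: there is one to choose, and the new graph has at least
    two. *)
Lemma R1_typical (R : realType) (t : nat) (g : mgraph) :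
  nedges g = t -> R1 R g (typical t.+1) = 1%E.
Proof.
move=> gt; apply: uniform_image_eq1 => [|v]; first by rewrite card_ord nverts_gt0.
by split=> [|_]; rewrite ?nedges_add_vertex ?gt//= ltnS nverts_gt0.
Qed.

Lemma R2_typical (R : realType) (t : nat) (g : mgraph) :
  nedges g = t -> (1 < nverts g)%N -> R2 R g (typical t.+1) = 1%E.
Proof.
move=> gt g1; apply: uniform_image_eq1 => [|p].
  apply/card_gt0P.
  (* The pair of vertices 0 and 1. *)
  by exists (exist _ (Ordinal (nverts_gt0 g), Ordinal g1) isT).
by split=> [|_]; rewrite ?nedges_add_edge ?gt.
Qed.

Lemma step_typical (R : realType) (q : R) (t : nat) (g : mgraph) :
  typical t g -> step q t g (typical t.+1) = 1%E.
Proof.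
move=> [gt g1]; rewrite /step; case: eqP => [_|/eqP t0]; first exact: R1_typical.
(* Both outcomes of the coin lead to a typical graph, so the set of good outcomes is all of
   [bool]. *)
apply: (@prob_bind_eq1 _ _ _ _ _ _ _ _ setT) => //; first exact: probability_setT.
by move=> [] _ /=; [exact: R1_typical | apply: R2_typical; rewrite ?g1 ?lt0n].
Qed.

Lemma law_typical (R : realType) (q : R) (t : nat) :
  law q t (typical t) = 1%E.
Proof.
elim: t => [|t IH] /=.
  by rewrite diracE mem_set//; split => //; exact: size_mset0.
by apply: (@prob_bind_eq1 _ _ _ _ _ _ _ _ (typical t)) => // g; exact: step_typical.
Qed.

Theorem lemma5p1 (R : realType) (q : R) (hq : 0 < q < 1) (t m : nat) :
  law q t [set g | nedges g = m] = (if t == m then 1 else 0)%E.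
Proof.
have le1 (A : set mgraph) : typical t `<=` A -> law q t A = 1%E.
  move=> tA; apply/eqP; rewrite eq_le probability_le1//= -(law_typical _ q t).
  by rewrite le_measure ?inE.
case: eqP => [<-|tm]; first by apply: le1 => g [].
(* The complement of the event contains [typical t], so the event has mass 1 - 1. *)
rewrite -[X in law q t X]setCK probability_setC// le1 ?subee// => g [gt _] gm.
by apply: tm; rewrite -gt.
Qed.
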